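(* Let $\mathcal{F}$ be a hereditary family of graphs such that $C_4$ is the only graph in $\operatorname{obs}(\mathcal{F})$ which is not point-determining. Then the set of minimal obstructions to full $\mathcal{F}$-colouring is $$\bigl(\operatorname{obs}(\mathcal{F})\setminus\{C_4\}\bigr)\cup\{X\in F_{C_4} : X \text{ is } (\operatorname{obs}(\mathcal{F})\setminus\{C_4\})\text{-free}\}.$$
   Context: Graphs are finite and undirected, with neither loops nor parallel edges, and are considered up to isomorphism. A family of graphs is hereditary if it is closed under taking induced subgraphs. $\operatorname{obs}(\mathcal{F})$ is the set of minimal $\mathcal{F}$-obstructions, i.e. graphs not in $\mathcal{F}$ all of whose proper induced subgraphs are in $\mathcal{F}$. A graph is $\mathcal{X}$-free if it has no induced subgraph isomorphic to a member of $\mathcal{X}$. Two distinct vertices are false twins if they are nonadjacent and have the same (open) neighbourhood; a graph is point-determining if it has no pair of false twins. A full homomorphism from $G$ to $H$ is a function $\varphi\colon V_G\to V_H$ such that, for all $u,v\in V_G$, $uv\in E_G$ if and only if $\varphi(u)\varphi(v)\in E_H$. A graph is fully $\mathcal{F}$-colourable if it admits a full homomorphism to some graph in $\mathcal{F}$; a minimal obstruction to full $\mathcal{F}$-colouring is a graph that is not fully $\mathcal{F}$-colourable but all of whose proper induced subgraphs are. $F_{C_4}=\{A,B,\text{house},\overline{X_{170}},\overline{2P_3}\}$. Starting from a 4-cycle $u_1u_2u_3u_4u_1$: the house is obtained by adding a vertex adjacent to exactly $u_1,u_2$; $A$ is obtained by adding two nonadjacent vertices $v,w$, with $v$ adjacent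 only to $u_1$ and $w$ only to $u_2$; $B$ is obtained from $A$ by adding the edge $vw$; $\overline{X_{170}}$ is obtained by adding two nonadjacent vertices $v,w$ with $v$ adjacent exactly to $u_1$ and $w$ adjacent exactly to $u_1,u_2,u_3$; $\overline{2P_3}$ is the complement of the disjoint union of two paths on three vertices. *)

(* Defs.v *)
From mathcomp Require Import all_boot.
Set Implicit Arguments.
Unset Strict Implicit.
Unset Printing Implicit Defensive.

(* Finite simple graphs; the graph with no vertices is allowed. *)
Record sgraph : Type := SGraph {
  vert :> finType;
  edge : rel vert;
  edge_sym : symmetric edge;
  edge_irr : irreflexive edge }.
Arguments edge {s}.

Definition giso (G H : sgraph) : Prop :=
  exists2 f : G -> H, bijective f & forall u v : G, edge (f u) (f v) = edge u v.

Section Induced.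
Variables (G : sgraph) (S : {set G}).
Let V : finType := {x : G | x \in S}.
Definition induced_edge : rel V := fun u v => edge (val u) (val v).
Lemma induced_sym : symmetric induced_edge.
Proof. by move=> u v; apply: edge_sym. Qed.
Lemma induced_irr : irreflexive induced_edge.
Proof. by move=> u; apply: edge_irr. Qed.
Definition induced : sgraph := SGraph induced_sym induced_irr.
End Induced.

(* Graphs are considered up to isomorphism: a family of graphs is a predicate
   that does not distinguish isomorphic graphs. *)
Definition iso_closed (F : sgraph -> Prop) : Prop :=
  forall G H : sgraph, giso G H -> F G -> F H.

Definition hereditary (F : sgraph -> Prop) : Prop :=
  forall (G : sgraph) (S : {set G}), F G -> F (induced S).

Definition obs (F : sgraph -> Prop) (G : sgraph) : Prop :=
  ~ F G /\ forall S : {set G}, S \proper [set: G] -> F (induced S).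

Definition free (X : sgraph -> Prop) (G : sgraph) : Prop :=
  ~ exists (S : {set G}) (H : sgraph), X H /\ giso (induced S) H.

Definition false_twins (G : sgraph) (u v : G) : Prop :=
  [/\ u != v, ~~ edge u v & forall w : G, edge u w = edge v w].

Definition point_determining (G : sgraph) : Prop :=
  ~ exists u v : G, false_twins u v.

Definition full_hom (G H : sgraph) (phi : G -> H) : Prop :=
  forall u v : G, edge u v = edge (phi u) (phi v).

Definition fully_colourable (F : sgraph -> Prop) (G : sgraph) : Prop :=
  exists2 H : sgraph, F H & exists phi : G -> H, full_hom phi.

(* The graph on {0, ..., n-1} whose edges are the pairs listed in s, each given
   in one (arbitrary) orientation. *)
Section OfEdges.
Variables (n : nat) (s : seq (nat * nat)).
Definition of_edges_rel : rel 'I_n := fun i j =>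
  (i != j) && (((i : nat, j : nat) \in s) || ((j : nat, i : nat) \in s)).
Lemma of_edges_sym : symmetric of_edges_rel.
Proof. by move=> i j; rewrite /of_edges_rel eq_sym orbC. Qed.
Lemma of_edges_irr : irreflexive of_edges_rel.
Proof. by move=> i; rewrite /of_edges_rel eqxx. Qed.
Definition of_edges : sgraph := SGraph of_edges_sym of_edges_irr.
End OfEdges.

Section Complement.
Variable G : sgraph.
Definition compl_rel : rel G := fun u v => (u != v) && ~~ edge u v.
Lemma compl_sym : symmetric compl_rel.
Proof. by move=> u v; rewrite /compl_rel eq_sym edge_sym. Qed.
Lemma compl_irr : irreflexive compl_rel.
Proof. by move=> u; rewrite /compl_rel eqxx. Qed.
Definition compl_graph : sgraph := SGraph compl_sym compl_irr.
End Complement.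

Section DisjointUnion.
Variables G H : sgraph.
Definition disj_union_rel : rel (G + H)%type := fun x y =>
  match x, y with
  | inl u, inl v => edge u v
  | inr u, inr v => edge u v
  | _, _ => false
  end.
Lemma disj_union_sym : symmetric disj_union_rel.
Proof. by case=> u [] v //=; apply: edge_sym. Qed.
Lemma disj_union_irr : irreflexive disj_union_rel.
Proof. by case=> u /=; apply: edge_irr. Qed.
Definition disj_union : sgraph := SGraph disj_union_sym disj_union_irr.
End DisjointUnion.

(* The 4-cycle u1 u2 u3 u4 is 0, 1, 2, 3; the added vertices v, w are 4, 5. *)
Definition C4_edges : seq (nat * nat) := [:: (0, 1); (1, 2); (2, 3); (3, 0)].

Definition C4 : sgraph := of_edges 4 C4_edges.
Definition house : sgraph := of_edges 5 (C4_edges ++ [:: (4, 0); (4, 1)]).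
Definition graphA : sgraph := of_edges 6 (C4_edges ++ [:: (4, 0); (5, 1)]).
Definition graphB : sgraph :=
  of_edges 6 (C4_edges ++ [:: (4, 0); (5, 1); (4, 5)]).
Definition co_X170 : sgraph :=
  of_edges 6 (C4_edges ++ [:: (4, 0); (5, 0); (5, 1); (5, 2)]).

Definition P3 : sgraph := of_edges 3 [:: (0, 1); (1, 2)].
Definition co_2P3 : sgraph := compl_graph (disj_union P3 P3).

Definition F_C4 (X : sgraph) : Prop :=
  giso X graphA \/ giso X graphB \/ giso X house \/ giso X co_X170
  \/ giso X co_2P3.

Definition obs_minus_C4 (F : sgraph -> Prop) (X : sgraph) : Prop :=
  obs F X /\ ~ giso X C4.

(* Main.v *)
Require Import Defs.
From mathcomp Require Import all_boot.
From Stdlib Require Import Classical.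
Set Implicit Arguments.
Unset Strict Implicit.
Unset Printing Implicit Defensive.

(** Write [C] for the family of fully [F]-colourable graphs.  A full
    homomorphism identifies only equal vertices or false twins, so on a
    point-determining graph it is an embedding: for such graphs, belonging to
    [C] and belonging to [F] are the same thing ([colourable_pd]).  On the other
    hand, deleting one of two false twins does not affect colourability, so
    minimal obstructions to [C] are point-determining ([obs_colourable_pd]).

    An obstruction of [F] other than [C4] is point-determining, hence not in
    [C], while its proper induced subgraphs are in [F] and hence in [C].  So it
    is an obstruction of [C].  Any other obstruction [X] of [C] contains no
    member of [obs F] besides [C4]; being outside [F], it contains [C4].

    Two facts about the five graphs of [F_C4] then finish the proof.  First,
    every point-determining graph containing [C4] contains one of the five
    ([pd_C4_contains_code]): some vertex separates each of the two nonadjacent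
    pairs of the cycle, and the ways in which two such vertices attach to the
    cycle and to each other produce exactly these graphs.  Second, deleting any
    vertex from one of the five leaves a graph that becomes [C4]-free after
    deleting at most one of two false twins ([code_foldP]).  Hence, as soon as
    one of the five contains no obstruction of [F] besides [C4], it is an
    obstruction of [C]; by minimality [X] is isomorphic to the one it contains.

    The second fact and some smaller ones are finite: the five graphs are coded
    by edge lists on initial segments of the natural numbers, on which they are
    decided by evaluation. *)

(** * Embeddings and minimal obstructions *)

Definition embeds (H G : sgraph) : Prop :=
  exists2 f : H -> G, injective f & full_hom f.

Lemma embeds_trans H G K : embeds H G -> embeds G K -> embeds H K.
Proof.
case=> f injf homf [g injg homg]; exists (g \o f); first exact: inj_comp.
by move=> u v; rewrite homf homg.
Qed.

Lemma giso_sym G H : giso G H -> giso H G.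
Proof.
case=> f [g fK gK] homf; exists g; first by exists f.
by move=> u v; rewrite -homf !gK.
Qed.

Lemma giso_trans G H K : giso G H -> giso H K -> giso G K.
Proof.
case=> f bijf homf [g bijg homg]; exists (g \o f); first exact: bij_comp.
by move=> u v; rewrite /= homg homf.
Qed.

Lemma giso_embeds G H : giso G H -> embeds G H.
Proof. by case=> f /bij_inj injf homf; exists f. Qed.

Lemma giso_card G H : giso G H -> #|G| = #|H|.
Proof. by case=> f bijf _; apply: bij_eq_card bijf. Qed.

Lemma embeds_giso H G : embeds H G -> #|G| <= #|H| -> giso H G.
Proof. by case=> f injf homf le; exists f => //; apply: inj_card_bij. Qed.

Lemma card_induced (G : sgraph) (S : {set G}) : #|induced S| = #|S|.
Proof. by rewrite card_sig; apply: eq_card. Qed.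

Lemma embeds_induced (G : sgraph) (S : {set G}) : embeds (induced S) G.
Proof. by exists val => //; apply: val_inj. Qed.

Lemma full_hom_into (H G : sgraph) (S : {set G}) (f : H -> G) :
  full_hom f -> (forall x, f x \in S) ->
  exists2 g : H -> induced S, full_hom g & forall x, val (g x) = f x.
Proof.
by move=> homf fS; exists (fun x => exist _ (f x) (fS x)).
Qed.

Lemma embeds_image H G :
  embeds H G -> exists2 S : {set G}, #|S| = #|H| & giso (induced S) H.
Proof.
case=> f injf homf; exists [set f x | x : H]; first exact: card_imset.
have fS x : f x \in [set f x | x : H] by apply: imset_f.
have [g homg vg] := full_hom_into homf fS.
apply: giso_sym; apply: embeds_giso; last by rewrite card_induced card_imset.
by exists g => // x y /(congr1 val); rewrite !vg => /injf.
Qed.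

Lemma freeE (O : sgraph -> Prop) X :
  free O X <-> forall H, O H -> ~ embeds H X.
Proof.
split=> [frX H OH /embeds_image [S _ iS] | frX [S [H [OH /giso_sym iS]]]].
  by apply: frX; exists S, H.
apply: (frX H OH); apply: embeds_trans (embeds_induced S).
exact: giso_embeds.
Qed.

Lemma free_embeds (O : sgraph -> Prop) H X : free O X -> embeds H X -> free O H.
Proof.
move=> /freeE frX eHX; apply/freeE => K OK eKH.
exact: (frX K OK (embeds_trans eKH eHX)).
Qed.

Lemma hereditary_embeds (F : sgraph -> Prop) H G :
  iso_closed F -> hereditary F -> embeds H G -> F G -> F H.
Proof.
by move=> F_iso F_her /embeds_image [S _ iS] FG; apply: F_iso iS (F_her _ _ _).
Qed.

Lemma obsE (F : sgraph -> Prop) G : iso_closed F ->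
  obs F G <-> ~ F G /\ forall H, embeds H G -> #|H| < #|G| -> F H.
Proof.
move=> F_iso; split=> [[nF prF]|[nF prF]]; split=> //.
  move=> H /embeds_image [S cS iS] ltHG; apply: F_iso iS (prF _ _).
  by rewrite properEcard subsetT cardsT cS.
move=> S; rewrite properEcard cardsT => /andP [_ ltS].
by apply: prF; [apply: embeds_induced | rewrite card_induced].
Qed.

Lemma obs_iso (F : sgraph -> Prop) : iso_closed F -> iso_closed (obs F).
Proof.
move=> F_iso G H iGH /(obsE G F_iso) [nF prF]; apply/(obsE H F_iso).
have iHG := giso_sym iGH.
split=> [/(F_iso _ _ iHG)//|K eK ltK]; apply: prF.
  exact: embeds_trans eK (giso_embeds iHG).
by rewrite (giso_card iGH).
Qed.

Lemma obs_embeds (F : sgraph -> Prop) X Y :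
  iso_closed F -> obs F X -> embeds Y X -> ~ F Y -> giso Y X.
Proof.
move=> F_iso /(obsE X F_iso) [_ prF] eYX nFY; apply: embeds_giso => //.
by rewrite leqNgt; apply/negP => /(prF _ eYX).
Qed.

Lemma contains_obs (F : sgraph -> Prop) G :
  ~ F G -> exists2 H, embeds H G & obs F H.
Proof.
have [n] := ubnP #|G|; elim: n G => // n IHn G /ltnSE leG nFG.
have [prF|] := classic (forall S : {set G}, S \proper [set: G] -> F (induced S)).
  by exists G => //; exists id.
move=> /not_all_ex_not [S nprS]; have [prS nFS] := imply_to_and _ _ nprS.
have ltS: #|induced S| < n.
  by apply: leq_trans leG; rewrite card_induced -cardsT proper_card.
have [H eH oH] := IHn _ ltS nFS.
by exists H => //; apply: embeds_trans eH (embeds_induced S).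
Qed.

(** * Full homomorphisms and false twins *)

(** Vertices with the same image are nonadjacent and have the same neighbours,
    so they are either equal or false twins. *)
Lemma pd_full_hom_inj (G H : sgraph) (f : G -> H) :
  point_determining G -> full_hom f -> injective f.
Proof.
move=> pdG homf u v fuv; apply/eqP/negPn/negP => neq_uv.
apply: pdG; exists u, v; split=> //; first by rewrite homf fuv edge_irr.
by move=> w; rewrite !homf fuv.
Qed.

Section Colourable.
Variable F : sgraph -> Prop.
Let C := fully_colourable F.

Lemma colourable_full_hom (G H : sgraph) (f : G -> H) : full_hom f -> C H -> C G.
Proof.
move=> homf [K FK [g homg]]; exists K => //; exists (g \o f).
by move=> u v; rewrite homf homg.
Qed.

Lemma colourable_sub G : F G -> C G.
Proof. by exists G => //; exists id. Qed.

Lemma colourable_iso : iso_closed C.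
Proof.
by move=> G H /giso_sym /giso_embeds [f _]; apply: colourable_full_hom.
Qed.

Hypotheses (F_iso : iso_closed F) (F_her : hereditary F).

Lemma colourable_pd G : point_determining G -> C G -> F G.
Proof.
move=> pdG [H FH [f homf]]; apply: hereditary_embeds FH => //.
by exists f => //; apply: pd_full_hom_inj homf.
Qed.

(** Sending one of two false twins to the other retracts the graph onto a proper
    induced subgraph. *)
Lemma obs_colourable_pd X : obs C X -> point_determining X.
Proof.
move=> [nCX prC] [u [v [neq_uv _ twin]]]; apply: nCX.
pose f x := if x == u then v else x.
have homf: full_hom f.
  move=> x y; rewrite /f.
  case: (x =P u) => [->|_]; case: (y =P u) => [->|_] //.
  - by rewrite !edge_irr.
  - by rewrite edge_sym twin edge_sym.
have fS x : f x \in [set~ u].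
  by rewrite !inE /f; case: ifP => [_|->//]; rewrite eq_sym.
have [g homg _] := full_hom_into homf fS.
apply: colourable_full_hom homg (prC _ _).
by apply/properP; split; [apply: subsetT | exists u; rewrite !inE ?eqxx].
Qed.

(** A point-determining obstruction of [F] is not colourable, since it would then
    be in [F]; the members of [F] are colourable. *)
Lemma pd_obs_colourable X : point_determining X -> obs F X -> obs C X.
Proof.
move=> pdX [nFX prF]; split=> [/(colourable_pd pdX)//|S /prF].
exact: colourable_sub.
Qed.

End Colourable.

(** * Graphs coded by edge lists *)

(** The relation of [of_edges n s], extended to all natural numbers so that it
    can be evaluated. *)
Definition adj (s : seq (nat * nat)) : rel nat :=
  fun i j => (i != j) && (((i, j) \in s) || ((j, i) \in s)).

Lemma of_edgesE n s (i j : of_edges n s) : edge i j = adj s i j.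
Proof. by []. Qed.

Lemma of_edges_inord n s i j : i <= n -> j <= n ->
  @edge (of_edges n.+1 s) (inord i) (inord j) = adj s i j.
Proof.
move=> lein lejn.
by rewrite -[LHS]/(adj s (@inord n i) (@inord n j)) !inordK.
Qed.

Lemma all_iotaP n (P : pred nat) :
  reflect (forall i : 'I_n, P i) (all P (iota 0 n)).
Proof.
apply: (iffP allP) => [allP' i|allP' i];
  first by apply: allP'; rewrite mem_iota ltn_ord.
by rewrite mem_iota => /= ltin; apply: (allP' (Ordinal ltin)).
Qed.

Lemma has_iotaP n (P : pred nat) :
  reflect (exists i : 'I_n, P i) (has P (iota 0 n)).
Proof.
apply: (iffP hasP) => [[i]|[i Pi]];
  last by exists (val i); rewrite ?mem_iota ?ltn_ord.
by rewrite mem_iota => /= ltin; exists (Ordinal ltin).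
Qed.

Definition pd_code n s : bool :=
  all (fun i => all (fun j =>
    (i == j) || has (fun k => adj s i k != adj s j k) (iota 0 n))
  (iota 0 n)) (iota 0 n).

Lemma pd_codeP n s : pd_code n s -> point_determining (of_edges n s).
Proof.
move=> /all_iotaP pd [u [v [neq_uv _ twin]]].
have /all_iotaP/(_ v)/orP[/eqP/val_inj eq_uv|/has_iotaP[k]] := pd u.
  by rewrite eq_uv eqxx in neq_uv.
by rewrite -!(of_edgesE (n := n)) twin eqxx.
Qed.

(** Only the pairs [i < j] are compared, and no distinctness is asked of the
    entries of [t]: for a point-determining code it follows from
    [pd_full_hom_inj]. *)
Definition reads (G : sgraph) (x0 : G) (t : seq G) n s : bool :=
  all (fun j => all (fun i => edge (nth x0 t i) (nth x0 t j) == adj s i j)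
    (iota 0 j)) (iota 0 n).

Lemma reads_embeds (G : sgraph) (x0 : G) t n s :
  pd_code n s -> reads x0 t n s -> embeds (of_edges n s) G.
Proof.
move=> /pd_codeP pd /all_iotaP rd.
pose f (i : of_edges n s) := nth x0 t i.
have lt_hom (i j : of_edges n s) : val i < val j -> edge i j = edge (f i) (f j).
  move=> ltij; apply/esym/eqP.
  by have /all_iotaP/(_ (Ordinal ltij)) := rd j.
have homf: full_hom f.
  move=> i j; case: (ltngtP (val i) (val j)) => [|lt|/val_inj->].
  - exact: lt_hom.
  - by rewrite edge_sym lt_hom // edge_sym.
  - by rewrite !edge_irr.
by exists f => //; apply: pd_full_hom_inj homf.
Qed.

Definition extends_C4 n s : bool :=
  (4 <= n) && all (fun i => all (fun j =>
    adj C4_edges i j == adj s i j) (iota 0 4)) (iota 0 4).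

Lemma extends_C4P n s : extends_C4 n s -> embeds C4 (of_edges n s).
Proof.
move=> /andP[le4n /all_iotaP ext].
exists (fun i : C4 => widen_ord le4n i : of_edges n s).
  by move=> i j /(congr1 val) eq_ij; apply: val_inj.
by move=> i j; have /all_iotaP/(_ j)/eqP := ext i.
Qed.

(** * Deleting a vertex and one of two false twins *)

(** A 4-cycle is searched for through its diagonals [p r] and [q t]: computing the
    common neighbours of [p] and [r] first keeps the evaluation short. *)
Definition has_C4 s (l : seq nat) : bool :=
  has (fun p => has (fun r =>
    let N := [seq q <- l | adj s p q && adj s r q] in
    [&& p != r, ~~ adj s p r &
      has (fun q => has (fun t => (q != t) && ~~ adj s q t) N) N]) l) l.

Lemma embeds_has_C4 n s (T : {set of_edges n s}) (l : seq nat) :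
  {in T, forall x : of_edges n s, val x \in l} ->
  embeds C4 (induced T) -> has_C4 s l.
Proof.
move=> Tl [f injf homf].
pose g (k : nat) : of_edges n s := val (f (inord k)).
have gl k : val (g k) \in l by apply: Tl; apply: valP.
have ginord i j : i < 4 -> j < 4 -> val (g i) = val (g j) -> i = j.
  move=> i4 j4 /val_inj/val_inj/injf/(congr1 (@nat_of_ord 4)).
  by rewrite !inordK.
have gadj i j : i < 4 -> j < 4 -> adj s (val (g i)) (val (g j)) = adj C4_edges i j.
  by move=> i4 j4; rewrite -(@of_edges_inord 3 C4_edges).
have neq i j : i < 4 -> j < 4 -> i != j -> val (g i) != val (g j).
  by move=> i4 j4; apply: contraNneq => /(ginord _ _ i4 j4)->.
apply/hasP; exists (val (g 0)) => //; apply/hasP; exists (val (g 2)) => //.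
rewrite neq // gadj //=; apply/hasP; exists (val (g 1)).
  by rewrite mem_filter gl !gadj.
apply/hasP; exists (val (g 3)); first by rewrite mem_filter gl !gadj.
by rewrite neq // gadj.
Qed.

(** Once [v] is deleted, [a] is either gone as well or a false twin of [b]. *)
Definition folds n s v a b : bool :=
  (a == v) || [&& b != v, b != a &
    all (fun x => (x == v) || (adj s a x == adj s b x)) (iota 0 n)].

Definition critical_code n s : bool :=
  all (fun v => has (fun a => has (fun b =>
    folds n s v a b) (iota 0 n) &&
    ~~ has_C4 s [seq x <- iota 0 n | (x != v) && (x != a)])
  (iota 0 n)) (iota 0 n).

Lemma code_foldP n s : critical_code n s -> forall v : of_edges n s,
  exists2 T : {set of_edges n s}, ~ embeds C4 (induced T) &
  exists phi : induced [set~ v] -> induced T, full_hom phi.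
Proof.
move=> /all_iotaP crit v.
have /has_iotaP[a /andP[/has_iotaP[b fold] noC4]] := crit v.
exists [set x : of_edges n s | (x != v) && (x != a)].
  move=> eC4; case/negP: noC4; apply: embeds_has_C4 eC4 => x.
  by rewrite inE mem_filter mem_iota ltn_ord => /= ->.
pose f (x : induced [set~ v]) : of_edges n s := if val x == a then b else val x.
have neq_v (x : induced [set~ v]) : val x != v by have := valP x; rewrite !inE.
case/orP: fold => [/eqP/val_inj eq_av|/and3P[neq_bv neq_ba /all_iotaP twin]].
  have valT (x : induced [set~ v]) :
      val x \in [set x : of_edges n s | (x != v) && (x != a)].
    by rewrite inE eq_av andbb; apply: neq_v.
  have homval : @full_hom (induced [set~ v]) (of_edges n s) val by [].
  by have [g homg _] := full_hom_into homval valT; exists g.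
have homf: full_hom f.
  have twin' (x : induced [set~ v]) :
      edge (a : of_edges n s) (val x) = edge (b : of_edges n s) (val x).
    have /orP[eqv|/eqP//] := twin (val x).
    by case/negP: (neq_v x).
  move=> x y; rewrite /f; change (edge x y) with (edge (val x) (val y)).
  case: eqP (twin' x) (twin' y) => [->|_] tx ty; case: eqP ty => [->|_] ty //.
  - by rewrite !edge_irr.
  - by rewrite edge_sym tx edge_sym.
have fT (x : induced [set~ v]) :
    f x \in [set x : of_edges n s | (x != v) && (x != a)].
  rewrite inE /f; case: ifP => [_|->]; last by rewrite neq_v.
  by apply/andP; split.
by have [g homg _] := full_hom_into homf fT; exists g.
Qed.

(** * The five graphs *)

Definition co_2P3_edges : seq (nat * nat) :=
  C4_edges ++ [:: (4, 0); (4, 1); (4, 3); (5, 0); (5, 1); (5, 2); (4, 5)].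

(** The edge lists defining [graphA], [graphB], [house] and [co_X170], followed by
    [co_2P3] relabelled so that it too extends the 4-cycle on 0, 1, 2, 3. *)
Definition codes : seq (nat * seq (nat * nat)) :=
  [:: (6, C4_edges ++ [:: (4, 0); (5, 1)]);
      (6, C4_edges ++ [:: (4, 0); (5, 1); (4, 5)]);
      (5, C4_edges ++ [:: (4, 0); (4, 1)]);
      (6, C4_edges ++ [:: (4, 0); (5, 0); (5, 1); (5, 2)]);
      (6, co_2P3_edges)].

Lemma codes_ok : all (fun p =>
  [&& pd_code p.1 p.2, extends_C4 p.1 p.2 & critical_code p.1 p.2]) codes.
Proof. by vm_compute. Qed.

(** Vertices 0 and 2 of the cycle are an end and the middle of one of the two
    paths, and so are vertices 1 and 3 of the other. *)
Lemma co_2P3_code : giso (of_edges 6 co_2P3_edges) co_2P3.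
Proof.
have pd : pd_code 6 co_2P3_edges by vm_compute.
pose o k : P3 := inord k.
apply: embeds_giso; last by rewrite card_sum !card_ord.
apply: (@reads_embeds co_2P3 (inl (o 0))
  [:: inl (o 2); inr (o 2); inl (o 1); inr (o 1); inl (o 0); inr (o 0)]) => //.
have e i j : i < 3 -> j < 3 -> edge (o i) (o j) = adj [:: (0, 1); (1, 2)] i j.
  exact: (@of_edges_inord 2 [:: (0, 1); (1, 2)]).
have el i j : i < 3 -> j < 3 -> @edge co_2P3 (inl (o i)) (inl (o j)) =
   (i != j) && ~~ adj [:: (0, 1); (1, 2)] i j.
  move=> i3 j3; rewrite -e // /edge /= /compl_rel /=; congr (~~ _ && _).
  by rewrite -[inl _ == _]/(o i == o j) -val_eqE /= !inordK.
have er i j : i < 3 -> j < 3 -> @edge co_2P3 (inr (o i)) (inr (o j)) =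
   (i != j) && ~~ adj [:: (0, 1); (1, 2)] i j.
  move=> i3 j3; rewrite -e // /edge /= /compl_rel /=; congr (~~ _ && _).
  by rewrite -[inr _ == _]/(o i == o j) -val_eqE /= !inordK.
have elr i j : @edge co_2P3 (inl (o i)) (inr (o j)) = true by [].
have erl i j : @edge co_2P3 (inr (o i)) (inl (o j)) = true by [].
by rewrite /reads [iota 0 6]/= /all /iota /nth !(el, er, elr, erl).
Qed.

Lemma F_C4E X :
  F_C4 X <-> exists2 p, p \in codes & giso X (of_edges p.1 p.2).
Proof.
split.
  have mem k : k < 5 -> nth (0, [::]) codes k \in codes by move=> ?; apply: mem_nth.
  case=> [i|[i|[i|[i|i]]]].
  - by exists (nth (0, [::]) codes 0) => //; apply: mem.
  - by exists (nth (0, [::]) codes 1) => //; apply: mem.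
  - by exists (nth (0, [::]) codes 2) => //; apply: mem.
  - by exists (nth (0, [::]) codes 3) => //; apply: mem.
  - exists (nth (0, [::]) codes 4); first exact: mem.
    by apply: giso_trans i _; apply: giso_sym co_2P3_code.
case=> p; rewrite !inE => /or4P[|||/orP[]] /eqP-> i; rewrite /F_C4; try by intuition.
by do 4 right; apply: giso_trans i co_2P3_code.
Qed.

Definition contains_code (G : sgraph) : Prop :=
  exists2 p, p \in codes & embeds (of_edges p.1 p.2) G.

Lemma reads_contains (G : sgraph) (x0 : G) t p :
  p \in codes -> reads x0 t p.1 p.2 -> contains_code G.
Proof.
move=> pc rd; exists p => //; apply: reads_embeds rd.
by have /and3P[] := allP codes_ok p pc.
Qed.

(** The neighbours of [v] on the cycle are [u1] and possibly [u2], [u4], and those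
    of [w] are [u2] and possibly [u1], [u3].  A vertex with exactly two neighbours
    on the cycle gives a house; the remaining cases depend on whether [v] and [w]
    have one or three neighbours on the cycle and on whether they are adjacent.
    Each list given to [found] places the vertices 0, 1, ... of a code in [G];
    when a house appears, its 4-cycle may pass through [v] or [w]. *)
Lemma separated_C4_contains_code (G : sgraph) (u1 u2 u3 u4 v w : G) :
  edge u1 u2 -> edge u2 u3 -> edge u3 u4 -> edge u4 u1 ->
  ~~ edge u1 u3 -> ~~ edge u2 u4 ->
  edge u1 v -> ~~ edge u3 v -> edge u2 w -> ~~ edge u4 w ->
  contains_code G.
Proof.
move=> e12 e23 e34 e41 /negbTE e13 /negbTE e24 e1v /negbTE e3v e2w /negbTE e4w.
have sym b (x y : G) : edge x y = b -> edge y x = b by rewrite edge_sym.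
have [e21 e32 e43 e14] := And4 (sym _ _ _ e12) (sym _ _ _ e23) (sym _ _ _ e34)
  (sym _ _ _ e41).
have [e31 e42] := conj (sym _ _ _ e13) (sym _ _ _ e24).
have [ev1 ev3] := conj (sym _ _ _ e1v) (sym _ _ _ e3v).
have [ew2 ew4] := conj (sym _ _ _ e2w) (sym _ _ _ e4w).
have cyc := (e12, e23, e34, e41, e13, e24, e21, e32, e43, e14, e31, e42,
  e1v, e3v, e2w, e4w, ev1, ev3, ew2, ew4).
have found (t : seq G) k :
  k < 5 -> reads u1 t (nth (0, [::]) codes k).1 (nth (0, [::]) codes k).2 ->
  contains_code G.
  by move=> k5; apply: reads_contains; apply: mem_nth.
case ev2: (edge v u2); have e2v := sym _ _ _ ev2;
case ev4: (edge v u4); have e4v := sym _ _ _ ev4.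
- case ew1: (edge w u1); have e1w := sym _ _ _ ew1;
  case ew3: (edge w u3); have e3w := sym _ _ _ ew3.
  + case evw: (edge v w); have ewv := sym _ _ _ evw.
    * apply: (found [:: u1; u2; u3; u4; v; w] 4) => //.
      by rewrite /reads /= !(cyc, ev2, ev4, ew1, ew3, e2v, e4v, e1w, e3w, evw,
        ewv).
    (* The complement is the path u1 u3 v w u4 u2; leaving out u1 gives the
       complement of a path on five vertices, which is a house. *)
    * apply: (found [:: u3; u2; v; u4; w] 2) => //.
      by rewrite /reads /= !(cyc, ev2, ev4, ew1, ew3, e2v, e4v, e1w, e3w, evw,
        ewv).
  + apply: (found [:: u1; u2; u3; u4; w] 2) => //.
    by rewrite /reads /= !(cyc, ew1, ew3, e1w, e3w).
  + apply: (found [:: u2; u3; u4; u1; w] 2) => //.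
    by rewrite /reads /= !(cyc, ew1, ew3, e1w, e3w).
  + case evw: (edge v w); have ewv := sym _ _ _ evw.
    * apply: (found [:: u2; v; u4; u3; w] 2) => //.
      by rewrite /reads /= !(cyc, ev2, ev4, ew1, ew3, e2v, e4v, e1w, e3w, evw,
        ewv).
    * apply: (found [:: u2; u1; u4; u3; w; v] 3) => //.
      by rewrite /reads /= !(cyc, ev2, ev4, ew1, ew3, e2v, e4v, e1w, e3w, evw,
        ewv).
- apply: (found [:: u1; u2; u3; u4; v] 2) => //.
  by rewrite /reads /= !(cyc, ev2, ev4, e2v, e4v).
- apply: (found [:: u1; u4; u3; u2; v] 2) => //.
  by rewrite /reads /= !(cyc, ev2, ev4, e2v, e4v).
- case ew1: (edge w u1); have e1w := sym _ _ _ ew1;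
  case ew3: (edge w u3); have e3w := sym _ _ _ ew3.
  + case evw: (edge v w); have ewv := sym _ _ _ evw.
    * apply: (found [:: u1; w; u3; u4; v] 2) => //.
      by rewrite /reads /= !(cyc, ev2, ev4, ew1, ew3, e2v, e4v, e1w, e3w, evw,
        ewv).
    * apply: (found [:: u1; u2; u3; u4; v; w] 3) => //.
      by rewrite /reads /= !(cyc, ev2, ev4, ew1, ew3, e2v, e4v, e1w, e3w, evw,
        ewv).
  + apply: (found [:: u1; u2; u3; u4; w] 2) => //.
    by rewrite /reads /= !(cyc, ew1, ew3, e1w, e3w).
  + apply: (found [:: u2; u3; u4; u1; w] 2) => //.
    by rewrite /reads /= !(cyc, ew1, ew3, e1w, e3w).
  + case evw: (edge v w); have ewv := sym _ _ _ evw.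
    * apply: (found [:: u1; u2; u3; u4; v; w] 1) => //.
      by rewrite /reads /= !(cyc, ev2, ev4, ew1, ew3, e2v, e4v, e1w, e3w, evw,
        ewv).
    * apply: (found [:: u1; u2; u3; u4; v; w] 0) => //.
      by rewrite /reads /= !(cyc, ev2, ev4, ew1, ew3, e2v, e4v, e1w, e3w, evw,
        ewv).
Qed.

Lemma separating_vertex (G : sgraph) (u v : G) :
  point_determining G -> u != v -> ~~ edge u v -> exists w, edge u w != edge v w.
Proof.
move=> pdG neq_uv nadj.
have [/existsP//|/existsPn same] := boolP [exists w, edge u w != edge v w].
case: pdG; exists u, v; split=> // w; apply/eqP/negPn; apply: same.
Qed.

(** The reflections of the cycle reduce the ways in which a vertex can separate a
    nonadjacent pair to a single one for each pair. *)
Lemma pd_C4_contains_code (G : sgraph) :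
  point_determining G -> embeds C4 G -> contains_code G.
Proof.
move=> pdG [f injf homf]; pose o k : C4 := inord k.
have e i j : i < 4 -> j < 4 -> edge (f (o i)) (f (o j)) = adj C4_edges i j.
  by move=> i4 j4; rewrite -homf of_edges_inord.
have neq i j : i < 4 -> j < 4 -> i != j -> f (o i) != f (o j).
  by move=> i4 j4; rewrite (inj_eq injf) -val_eqE /= !inordK.
have [|v sep_v] := separating_vertex pdG (neq 0 2 isT isT isT).
  by rewrite e.
have [|w sep_w] := separating_vertex pdG (neq 1 3 isT isT isT).
  by rewrite e.
case ev0: (edge (f (o 0)) v) sep_v => /=; case ev2: (edge (f (o 2)) v) => // _;
case ew1: (edge (f (o 1)) w) sep_w => /=; case ew3: (edge (f (o 3)) w) => // _.
- by apply: (@separated_C4_contains_code G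
      (f (o 0)) (f (o 1)) (f (o 2)) (f (o 3)) v w);
    rewrite ?e ?ev0 ?ev2 ?ew1 ?ew3.
- by apply: (@separated_C4_contains_code G
      (f (o 0)) (f (o 3)) (f (o 2)) (f (o 1)) v w);
    rewrite ?e ?ev0 ?ev2 ?ew1 ?ew3.
- by apply: (@separated_C4_contains_code G
      (f (o 2)) (f (o 1)) (f (o 0)) (f (o 3)) v w);
    rewrite ?e ?ev0 ?ev2 ?ew1 ?ew3.
- by apply: (@separated_C4_contains_code G
      (f (o 2)) (f (o 3)) (f (o 0)) (f (o 1)) v w);
    rewrite ?e ?ev0 ?ev2 ?ew1 ?ew3.
Qed.

(** * The obstructions *)

Section Obstructions.
Variable F : sgraph -> Prop.
Hypotheses (F_iso : iso_closed F) (F_her : hereditary F).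

(** A graph outside [F] contains a minimal one, which is either [C4] or another
    obstruction. *)
Lemma free_C4free_mem G : free (obs_minus_C4 F) G -> ~ embeds C4 G -> F G.
Proof.
move=> /freeE frG nC4; apply: NNPP => /contains_obs[H eHG oH].
apply: (frG H _ eHG); split=> // /giso_sym/giso_embeds eC4.
exact: nC4 (embeds_trans eC4 eHG).
Qed.

Lemma F_C4_obs_colourable X : ~ F C4 ->
  F_C4 X -> free (obs_minus_C4 F) X -> obs (fully_colourable F) X.
Proof.
move=> nFC4 /F_C4E[[n s] pc iX] frX.
have /and3P[/= pd ext crit] := allP codes_ok _ pc.
apply: (obs_iso (@colourable_iso F) (giso_sym iX)).
have frY := free_embeds frX (giso_embeds (giso_sym iX)).
split=> [/(colourable_pd F_iso F_her (pd_codeP pd))|S].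
  by move/(hereditary_embeds F_iso F_her (extends_C4P ext)).
case/properP => _ [v _ vS]; have [T noC4 [phi homphi]] := code_foldP crit v.
have S_v (x : induced S) : val x \in [set~ v].
  by rewrite !inE; apply: contra vS => /eqP<-; apply: valP.
have homval : @full_hom (induced S) (of_edges n s) val by [].
have [g homg _] := full_hom_into homval S_v.
apply: colourable_full_hom homg _; apply: colourable_full_hom homphi _.
apply: colourable_sub; apply: free_C4free_mem noC4.
exact: free_embeds frY (embeds_induced T).
Qed.

End Obstructions.

Theorem lemma6 (F : sgraph -> Prop)
    (F_iso : iso_closed F) (F_hered : hereditary F)
    (F_C4_only : forall G : sgraph,
       (obs F G /\ ~ point_determining G) <-> giso G C4) :
  forall X : sgraph,
    obs (fully_colourable F) X <->
    (obs_minus_C4 F X \/ (F_C4 X /\ free (obs_minus_C4 F) X)).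
Proof.
have nFC4 : ~ F C4.
  have /F_C4_only[[]//] : giso C4 C4 by exists id => //; exists id.
have C_iso := @colourable_iso F.
have obsC Y : obs_minus_C4 F Y -> obs (fully_colourable F) Y.
  case=> oY nC4; apply: pd_obs_colourable => // tw.
  by apply: nC4; apply/F_C4_only; split=> // /(_ tw).
move=> X; split=> [oX|[/obsC//|[XC4 frX]]]; last exact: F_C4_obs_colourable.
have [|nX] := classic (obs_minus_C4 F X); first by left.
have frX : free (obs_minus_C4 F) X.
  apply/freeE => Y OY eYX; apply: nX.
  have iYX : giso Y X by apply: obs_embeds eYX (obsC _ OY).1.
  case: OY => oY nC4; split; first exact: obs_iso iYX oY.
  by move=> /(giso_trans iYX).
have eC4 : embeds C4 X.
  apply: NNPP => /(free_C4free_mem frX)/colourable_sub.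
  exact: oX.1.
have [[n s] pc eYX] := pd_C4_contains_code (obs_colourable_pd oX) eC4.
have YC4 : F_C4 (of_edges n s).
  by apply/F_C4E; exists (n, s) => //; exists id => //; exists id.
have oY := F_C4_obs_colourable F_iso F_hered nFC4 YC4 (free_embeds frX eYX).
have iYX : giso (of_edges n s) X := obs_embeds C_iso oX eYX oY.1.
by right; split=> //; apply/F_C4E; exists (n, s) => //; apply: giso_sym.
Qed.
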